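(* Let $\alpha\in\{-\frac12,0\}$, $r>0$, and $0<p\le1$. Then there is a constant $C>0$, independent of $n$, such that for all $n\in\mathbb{N}$ $$a_n(\mathcal{A}^r_{\alpha,p}([-1,1]))_{L^2(\mu_\alpha)}\ge C\,n^{-r}.$$
   Context: For $\alpha\in\{-\frac12,0\}$ let $\mu_\alpha$ be the probability measure on $[-1,1]$ with $\mathrm{d}\mu_\alpha(x)=c_\alpha(1-x^2)^\alpha\,\mathrm{d}x$, $c_\alpha=(\int_{-1}^1(1-x^2)^\alpha\,\mathrm{d}x)^{-1}$, and let $(p^\alpha_n)_{n\in\mathbb{N}_0}$ be the unique sequence of polynomials orthonormal in $L^2(\mu_\alpha)$ with $\deg p^\alpha_n=n$ and positive leading coefficient (Chebyshev polynomials of the first kind for $\alpha=-\frac12$, Legendre polynomials for $\alpha=0$). For $r\ge0$, $0<p\le1$, the Wiener-type space is $$\mathcal{A}^r_{\alpha,p}([-1,1])=\Big\{f=\sum_{n=0}^\infty\beta_np^\alpha_n:\ \|f\|_{\mathcal{A}^r_{\alpha,p}}:=\Big(\sum_{n\in\mathbb{N}_0}|\beta_n(1+n)^r|^p\Big)^{1/p}<\infty\Big\},$$ where $\beta_n=\langle f,p_n^\alpha\rangle_{L^2(\mu_\alpha)}$. For a quasi-normed space $\mathcal{F}$ continuously embedded into a normed space $X$, the $n$th approximation number is $a_n(\mathcal{F})_X=\inf_{\mathrm{rank}\,A\le n}\ \sup_{\|f\|_{\mathcal{F}}\le1}\|f-Af\|_X$, where the infimum runs over all bounded linear operators $A:\mathcal{F}\to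 X$ of rank at most $n$. *)

(* Defs.v *)
From HB Require Import structures.
From mathcomp Require Import all_boot all_order all_algebra.
From mathcomp Require Import all_classical all_reals all_analysis.
From mathcomp Require Import measurable_realfun.

Set Implicit Arguments.
Unset Strict Implicit.
Unset Printing Implicit Defensive.

Import Order.TTheory GRing.Theory Num.Theory.
Import numFieldNormedType.Exports.

Local Open Scope classical_set_scope.
Local Open Scope ring_scope.
Local Open Scope quotient_scope.

(* L2 mu is the quotient of the square-integrable functions by a.e. equality. *)
Section L2.
Context {d : measure_display} {T : measurableType d} {R : realType}.
Variable mu : {measure set T -> \bar R}.

Local Notation L2fun := (LfunType mu (@lee1n R 2)).
Implicit Types (f g : L2fun) (a : R).

Definition ae_null : {pred L2fun} :=
  fun f => `[< \forall x \ae mu, (f : T -> R) x = 0 >].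

Lemma ae_nullP f : reflect (\forall x \ae mu, f x = 0) (f \in ae_null).
Proof. exact: asboolP. Qed.

Lemma L2funB f g : (f - g : L2fun) =1 (fun x => f x - g x).
Proof. by []. Qed.

Lemma L2funD f g : (f + g : L2fun) =1 (fun x => f x + g x).
Proof. by []. Qed.

Lemma L2funZ a f : (a *: f : L2fun) =1 (fun x => a * f x).
Proof. by []. Qed.

Lemma ae_null_zmod_closed : zmod_closed ae_null.
Proof.
split; first by apply/ae_nullP; exact: aeW.
move=> f g /ae_nullP f0 /ae_nullP g0; apply/ae_nullP.
by apply: filterS2 f0 g0 => x fx gx; rewrite L2funB fx gx subrr.
Qed.

HB.instance Definition _ :=
  GRing.isZmodClosed.Build _ ae_null ae_null_zmod_closed.

Definition L2 : Type := Quotient.quot ae_null.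
HB.instance Definition _ := GRing.Zmodule.on L2.
HB.instance Definition _ := EqQuotient.on L2.

Lemma L2_eqP f g :
  (\pi_L2 f = \pi_L2 g) <-> (\forall x \ae mu, f x = g x).
Proof.
split.
- move=> /eqP; rewrite -Quotient.idealrBE => /ae_nullP.
  by apply: filterS => x; rewrite L2funB => /eqP; rewrite subr_eq0 => /eqP.
- move=> fg; apply/eqP; rewrite -Quotient.idealrBE; apply/ae_nullP.
  by apply: filterS fg => x fg; rewrite L2funB fg subrr.
Qed.

Lemma L2_reprP f : \forall x \ae mu, repr (\pi_L2 f) x = f x.
Proof. by apply/L2_eqP; rewrite reprK. Qed.

Definition L2scale a (u : L2) : L2 := \pi_L2 (a *: repr u).

Lemma L2scaleE a f : L2scale a (\pi_L2 f) = \pi_L2 (a *: f).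
Proof.
apply/L2_eqP; apply: filterS (L2_reprP f) => x fx.
by rewrite !L2funZ fx.
Qed.

Lemma L2piD f g : \pi_L2 (f + g) = \pi_L2 f + \pi_L2 g :> L2.
Proof. exact: (@Quotient.pi_add L2fun ae_null f g). Qed.

Lemma L2pi0 : \pi_L2 (0 : L2fun) = 0 :> L2.
Proof. by apply: (addrI (\pi_L2 (0 : L2fun) : L2)); rewrite -L2piD !addr0. Qed.

Fact L2scalerA a b (u : L2) : L2scale a (L2scale b u) = L2scale (a * b) u.
Proof. by elim/quotW: u => f; rewrite (L2scaleE b) !L2scaleE scalerA. Qed.

Fact L2scale1r : left_id 1 L2scale.
Proof. by elim/quotW => f; rewrite L2scaleE scale1r. Qed.

Fact L2scalerDr : right_distributive L2scale +%R.
Proof.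
move=> a; elim/quotW => f; elim/quotW => g.
by rewrite -L2piD !L2scaleE -L2piD scalerDr.
Qed.

Fact L2scalerDl (u : L2) : {morph L2scale^~ u : a b / a + b}.
Proof. by elim/quotW: u => f a b; rewrite !L2scaleE -L2piD scalerDl. Qed.

HB.instance Definition _ := GRing.Zmodule_isLmodule.Build R L2
  L2scalerA L2scale1r L2scalerDr L2scalerDl.

Lemma L2piZ a f : \pi_L2 (a *: f) = a *: \pi_L2 f :> L2.
Proof. by rewrite -L2scaleE. Qed.

Definition L2norm (u : L2) : R := fine ('N[mu]_2%:E [EFin \o repr u])%E.

Lemma L2normE f : L2norm (\pi_L2 f) = fine ('N[mu]_2%:E [EFin \o f])%E.
Proof.
rewrite /L2norm unlock; congr (fine (_ `^ _)%E).
apply: ae_eq_integral => //.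
- by apply/measurable_EFinP; apply: (measurableT_comp (measurable_powR _)) => //;
    exact: measurableT_comp.
- by apply/measurable_EFinP; apply: (measurableT_comp (measurable_powR _)) => //;
    exact: measurableT_comp.
by apply: filterS (L2_reprP f) => x /= -> _.
Qed.

Lemma ler_L2normD (u v : L2) : L2norm (u + v) <= L2norm u + L2norm v.
Proof.
elim/quotW: u => f; elim/quotW: v => g.
by rewrite -L2piD !L2normE; exact: ler_LnormD.
Qed.

Lemma L2normZ a (u : L2) : L2norm (a *: u) = `|a| * L2norm u.
Proof.
elim/quotW: u => f; rewrite -L2piZ !L2normE.
by rewrite LnormZ -(finite_norm_fine f).
Qed.

Lemma L2norm_eq0 (u : L2) : L2norm u = 0 -> u = 0.
Proof.
elim/quotW: u => f; rewrite L2normE => /fine_Lnormr_eq0 f0.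
by rewrite -L2pi0; apply/L2_eqP; apply: filterS f0 => x /(_ I).
Qed.


HB.instance Definition _ := Lmodule_isNormed.Build R L2
  ler_L2normD L2normZ L2norm_eq0.

Definition L2dot (u v : L2) : R := \int[mu]_x (repr u x * repr v x).

Lemma L2dotE f g : L2dot (\pi_L2 f) (\pi_L2 g) = \int[mu]_x (f x * g x).
Proof.
rewrite /L2dot /Rintegral; congr fine; apply: ae_eq_integral => //.
- by apply/measurable_EFinP; exact: measurable_funM.
- by apply/measurable_EFinP; exact: measurable_funM.
by apply: filterS2 (L2_reprP f) (L2_reprP g) => x fx gx _ /=; rewrite fx gx.
Qed.

Lemma L2fun_integrableM f g :
  mu.-integrable setT (EFin \o (fun x => f x * g x)).
Proof. by apply/Lfun1_integrable; apply: Lfun2_mul_Lfun1; exact: LfunP. Qed.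

Lemma L2dotP a (u v w : L2) :
  L2dot (a *: u + v) w = a * L2dot u w + L2dot v w.
Proof.
elim/quotW: u => f; elim/quotW: v => g; elim/quotW: w => h.
rewrite -L2piZ -L2piD !L2dotE.
under eq_Rintegral do rewrite L2funD L2funZ mulrDl -mulrA.
rewrite RintegralD// ?RintegralZl//; last 3 first.
- exact: L2fun_integrableM.
- have := @integrableZl _ _ _ mu setT measurableT a _ (L2fun_integrableM f h).
  by apply: eq_integrable => // x _ /=; rewrite EFinM.
- exact: L2fun_integrableM.
Qed.

End L2.

(* Spaces of convergent expansions u = \sum_n <u, e n> e n in L2 mu (convergence
   in norm) whose weighted coefficient sequence is p-summable. *)
Section wiener.
Context {d : measure_display} {T : measurableType d} {R : realType}.
Variables (mu : {measure set T -> \bar R}) (e : nat -> L2 mu) (r p : R).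

Definition wiener_enorm (u : L2 mu) : \bar R :=
  ((\sum_(n <oo) (`|L2dot u (e n) * (1 + n%:R) `^ r| `^ p)%:E) `^ p^-1)%E.

Hypothesis p01 : 0 < p <= 1.

(* The unused bound on p is an argument so that the closure properties, which
   rely on it, can be attached to the predicate. *)
Definition wiener_pred of 0 < p <= 1 : {pred L2 mu} := fun u =>
  `[< (wiener_enorm u < +oo)%E /\
      series (fun n => L2dot u (e n) *: e n) @ \oo --> u >].

Lemma powR_subadd (x y : R) : 0 <= x -> 0 <= y ->
  (x + y) `^ p <= x `^ p + y `^ p.
Proof.
move=> x0 y0; have /andP[p0 p1] := p01.
have [s0|] := eqVneq (x + y) 0.
  by rewrite s0 powR0 ?gt_eqF// addr_ge0// powR_ge0.
move=> s0; have s_gt0 : 0 < x + y by rewrite lt_neqAle eq_sym s0 addr_ge0.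
have H z : 0 <= z -> z <= x + y -> (x + y) `^ p * (z / (x + y)) <= z `^ p.
  rewrite le_eqVlt => /predU1P[<- _|z0 zs].
    by rewrite mul0r mulr0 powR_ge0.
  have -> : z `^ p = (x + y) `^ p * (z / (x + y)) `^ p.
    by rewrite -powRM ?divr_ge0 ?ltW// mulrC divfK.
  rewrite ler_wpM2l ?powR_ge0//; apply: ger1_powR => //.
  by rewrite divr_gt0//= ler_pdivrMr// mul1r.
rewrite -[leLHS]mulr1 -(divff s0) mulrDl mulrDr lerD// H//.
  by rewrite lerDl.
by rewrite lerDr.
Qed.

Lemma wiener_submod_closed : submod_closed (wiener_pred p01).
Proof.
have /andP[p0 p1] := p01.
have finE u : (wiener_enorm u < +oo)%E <->
    (\sum_(n <oo) (`|L2dot u (e n) * (1 + n%:R) `^ r| `^ p)%:E < +oo)%E.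
  split; first by apply: lty_poweRy; rewrite invr_neq0 ?gt_eqF.
  exact: poweR_lty.
have dot0 w : L2dot (0 : L2 mu) w = 0.
  by have := L2dotP (-1) 0 0 w; rewrite scaler0 addr0 mulN1r addNr.
split.
  apply/asboolP; split.
    apply/finE; rewrite eseries0// => n _ _.
    by rewrite dot0 mul0r normr0 powR0// gt_eqF.
  rewrite (_ : series _ = fun=> 0); first exact: cvg_cst.
  by apply/funext => n; rewrite /series/= big1// => i _; rewrite dot0 scale0r.
move=> a u v /asboolP[/finE fu cu] /asboolP[/finE fv cv]; apply/asboolP; split.
  apply/finE.
  pose b w n := (`|L2dot w (e n) * (1 + n%:R) `^ r| `^ p)%:E : \bar R.
  have b0 w n : (0 <= b w n)%E by rewrite lee_fin powR_ge0.
  apply: (@le_lt_trans _ _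
    (\sum_(n <oo) ((`|a| `^ p)%:E * b u n + b v n))%E).
    apply: lee_nneseries => [n _ _|n _]; first exact: b0.
    rewrite /b -EFinM -EFinD lee_fin -powRM//.
    apply: le_trans (powR_subadd _ _) => //.
    apply: ge0_ler_powR; rewrite ?nnegrE ?addr_ge0//; first exact: ltW.
    rewrite L2dotP mulrDl -mulrA -normrM; exact: ler_normD.
  rewrite nneseriesD; last 2 first.
  - by move=> n _ _; rewrite mule_ge0// lee_fin powR_ge0.
  - by move=> n _ _; exact: b0.
  rewrite nneseriesZl; last by move=> n _; exact: b0.
  apply: lte_add_pinfty; last exact: fv.
  by apply: lte_mul_pinfty; [rewrite lee_fin powR_ge0| |exact: fu].
rewrite (_ : series _ = (fun n => a *: series (fun n => L2dot u (e n) *: e n) n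
    + series (fun n => L2dot v (e n) *: e n) n)).
  apply: cvgD => //; exact: cvgZr.
apply/funext => n; rewrite /series/= scaler_sumr -big_split/=.
by apply: eq_bigr => i _; rewrite L2dotP scalerDl scalerA.
Qed.

HB.instance Definition _ :=
  GRing.isSubmodClosed.Build R (L2 mu) (wiener_pred p01) wiener_submod_closed.

Record wiener := Wiener { wiener_val : L2 mu ; _ : wiener_val \in wiener_pred p01 }.

HB.instance Definition _ := [isSub for wiener_val].
HB.instance Definition _ := [Choice of wiener by <:].
HB.instance Definition _ := [SubChoice_isSubLmodule of wiener by <:].

Definition wiener_norm (f : wiener) : R := fine (wiener_enorm (val f)).

End wiener.

(* F carries the quasi-norm qn and is embedded into X by iota. *)
Section approximation_number.
Context {R : realType} {F : lmodType R} {X : normedModType R}.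
Variables (qn : F -> R) (iota : {linear F -> X}).

Definition bounded_operator (A : F -> X) : Prop :=
  exists M : R, forall f, `|A f| <= M * qn f.

(* The range of A lies in the span of n vectors. *)
Definition rank_le (A : F -> X) (n : nat) : Prop :=
  exists v : 'I_n -> X, forall f, exists c : 'I_n -> R,
    A f = \sum_(i < n) c i *: v i.

Definition approximation_number (n : nat) : \bar R :=
  ereal_inf [set ereal_sup [set `|iota f - A f|%:E | f in [set f | qn f <= 1]]
    | A in [set A : {linear F -> X} | bounded_operator A /\ rank_le A n]].

End approximation_number.

(* mu_alpha is a measure on R carried by [-1, 1], so that its L2 space is the
   usual L2 space of the interval.  Points where 1 - x ^+ 2 <= 0, for which powR
   has a conventional value, are either outside [-1, 1] or negligible.  If the
   weight is not integrable, then jacobi_const = 0 and the measure is null; this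
   does not happen for alpha > -1. *)
Section jacobi.
Context {R : realType}.
Variable alpha : R.
Local Notation leb := (@lebesgue_measure R).

Definition jacobi_weight (x : R) : R := (1 - x ^+ 2) `^ alpha.

Definition jacobi_const : R :=
  (\int[leb]_(x in `[(-1 : R), 1]) jacobi_weight x)^-1.

Definition jacobi_measure (A : set (measurableTypeR R)) : \bar R :=
  (\int[leb]_(x in A `&` `[(-1 : R)%R, 1%R]) (jacobi_const * jacobi_weight x)%:E)%E.

Lemma jacobi_weight_ge0 x : 0 <= jacobi_weight x.
Proof. exact: powR_ge0. Qed.

Lemma jacobi_const_ge0 : 0 <= jacobi_const.
Proof. by rewrite invr_ge0 Rintegral_ge0// => x _; exact: jacobi_weight_ge0. Qed.

Lemma jacobi_density_ge0 x : 0 <= jacobi_const * jacobi_weight x.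
Proof. by rewrite mulr_ge0 ?jacobi_const_ge0 ?jacobi_weight_ge0. Qed.

Lemma measurable_jacobi_weight (A : set R) : measurable_fun A jacobi_weight.
Proof.
apply: measurable_funTS.
apply: (measurableT_comp (measurable_powR _)) => //.
by apply: measurable_funB => //; exact: measurable_funX.
Qed.

Let jacobi0 : jacobi_measure set0 = 0%E.
Proof. by rewrite /jacobi_measure set0I integral_set0. Qed.

Let jacobi_ge0 A : (0 <= jacobi_measure A)%E.
Proof. by apply: integral_ge0 => x _; rewrite lee_fin jacobi_density_ge0. Qed.

Let jacobi_sigma_additive : semi_sigma_additive jacobi_measure.
Proof.
move=> /= F mF tF mUF; rewrite /jacobi_measure; apply: cvg_toP.
  apply: ereal_nondecreasing_is_cvgn => m n mn.
  apply: lee_sum_nneg_natr => // k _ _; apply: integral_ge0 => /= x Fkx.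
  by rewrite lee_fin jacobi_density_ge0.
rewrite setI_bigcupl ge0_integral_bigcup//=.
- by move=> k; exact: measurableI.
- apply/measurable_EFinP; apply: measurable_funM => //.
  exact: measurable_jacobi_weight.
- by move=> x _; rewrite lee_fin jacobi_density_ge0.
- exact: trivIset_setIr.
Qed.

HB.instance Definition _ := isMeasure.Build _ _ _
  jacobi_measure jacobi0 jacobi_ge0 jacobi_sigma_additive.

Lemma jacobi_measureT_lty : (jacobi_measure setT < +oo)%E.
Proof.
rewrite /jacobi_measure setTI.
under eq_integral do rewrite EFinM.
rewrite ge0_integralZl_EFin//; last 3 first.
- by move=> x _; rewrite lee_fin jacobi_weight_ge0.
- by apply/measurable_EFinP; exact: measurable_jacobi_weight.
- exact: jacobi_const_ge0.
rewrite /jacobi_const /Rintegral.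
case: (integral _ _ _) => [x| |] /=; first by rewrite -EFinM ltry.
  by rewrite invr0 mul0e.
by rewrite invr0 mul0e.
Qed.

HB.instance Definition _ := Measure_isFinite.Build _ _ _ jacobi_measure
  (lty_fin_num_fun jacobi_measureT_lty).

Lemma jacobi_ae_itv : \forall x \ae jacobi_measure, x \in `[(-1 : R), 1].
Proof.
exists (~` `[(-1 : R), 1]%classic); split => //.
- exact: measurableC.
- by rewrite /= /jacobi_measure setICl integral_set0.
Qed.

Lemma horner_Lfun (q : {poly R}) : horner q \in Lfun jacobi_measure 2%:E.
Proof.
pose M := \sum_(i < size q) `|q`_i|.
have mq : measurable_fun setT (horner q : measurableTypeR R -> R).
  by apply: continuous_measurable_fun; exact: continuous_horner.
rewrite inE; apply/andP; split; rewrite inE//= /finite_norm unlock poweR_lty//.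
apply: (@le_lt_trans _ _ (\int[jacobi_measure]_x (M `^ 2)%:E)%E); last first.
  by rewrite integral_cst//= lte_mul_pinfty// ?lee_fin ?powR_ge0// jacobi_measureT_lty.
apply: ae_ge0_le_integral => //.
- by move=> x _; rewrite lee_fin powR_ge0.
- by apply/measurable_EFinP; apply: (measurableT_comp (measurable_powR _)) => //;
    exact: measurableT_comp.
- by move=> x _; rewrite lee_fin powR_ge0.
apply: (@filterS _ _ (ae_filter_ringOfSetsType jacobi_measure)) jacobi_ae_itv => x; rewrite in_itv/= => x1 _.
rewrite lee_fin; apply: ge0_ler_powR; rewrite ?nnegrE ?sumr_ge0//.
rewrite horner_coef (le_trans (ler_norm_sum _ _ _))// ler_sum// => i _.
by rewrite normrM ler_piMr// normrX exprn_ile1// ler_norml.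
Qed.

Definition polyL2 (q : {poly R}) : L2 jacobi_measure :=
  \pi_(L2 jacobi_measure) (Lfun_Sub (@lee1n R 2) (horner_Lfun q)).

Definition orthonormal_polys (P : nat -> {poly R}) : Prop :=
  [/\ forall n, size (P n) = n.+1,
      forall n, 0 < lead_coef (P n)
    & forall m n, L2dot (polyL2 (P m)) (polyL2 (P n)) = (m == n)%:R].

End jacobi.

(* Main.v *)
(** The vectors [e_k], [k < 2n], scaled to quasi-norm one in the Wiener space,
    all have norm at least [(2n)^-r] in [L2].  The squared distances from [N]
    orthonormal vectors to a common subspace of dimension at most [n] add up to
    at least [N - n]; for [N = 2n] one of them is therefore at least [1/2],
    whatever the approximating operator of rank [n]. *)
Require Import Defs.
From mathcomp Require Import all_boot all_order all_algebra.
From mathcomp Require Import all_classical all_reals all_analysis.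
From mathcomp Require Import lra.

Set Implicit Arguments.
Unset Strict Implicit.
Unset Printing Implicit Defensive.

Import Order.TTheory GRing.Theory Num.Theory.
Import numFieldNormedType.Exports.

Local Open Scope classical_set_scope.
Local Open Scope ring_scope.

Section frobenius.
Variable F : realFieldType.

Lemma mxtrace_mul_tr m n (A : 'M[F]_(m, n)) :
  \tr (A *m A^T) = \sum_i \sum_j A i j ^+ 2.
Proof.
apply: eq_bigr => i _; rewrite mxE; apply: eq_bigr => j _.
by rewrite mxE expr2.
Qed.

Lemma mxtrace_mul_tr_ge0 m n (A : 'M[F]_(m, n)) : 0 <= \tr (A *m A^T).
Proof.
by rewrite mxtrace_mul_tr; do 2![apply: sumr_ge0 => ? _]; exact: sqr_ge0.
Qed.

Lemma mul_rV_tr_eq0 n (u : 'rV[F]_n) : u *m u^T = 0 -> u = 0.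
Proof.
move=> /(congr1 (@mxtrace _ _)); rewrite mxtrace_mul_tr big_ord1 mxtrace0.
move=> /eqP; rewrite psumr_eq0; last by move=> j _; exact: sqr_ge0.
move=> /allP u0; apply/rowP => j; rewrite mxE.
by have := u0 j (mem_index_enum _); rewrite sqrf_eq0 => /eqP.
Qed.

(** If [u *m B *m B^T = 0], then [u *m B] has zero sum of squares; over an ordered field it
    vanishes, and freeness gives [u = 0]. *)
Lemma gram_unitmx m n (B : 'M[F]_(m, n)) : row_free B -> B *m B^T \in unitmx.
Proof.
move=> Bfree; rewrite -row_free_unit; apply: inj_row_free => u uBB.
apply: (row_free_inj Bfree); rewrite mul0mx; apply: mul_rV_tr_eq0.
by rewrite trmx_mul mulmxA -(mulmxA u) uBB mul0mx.
Qed.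

(** Since [M *m Q = 0] for the projection [Q] below, [D = 1 - M] satisfies [D *m Q = Q]. Hence
    [D - Q] has squared Frobenius norm [\tr (D *m D^T) - \tr Q], which is nonnegative. *)
Lemma frobenius_sub1_ge N (M : 'M[F]_N) :
  N%:R - (\rank M)%:R <= \tr ((1%:M - M) *m (1%:M - M)^T).
Proof.
pose B := row_base M; pose G := invmx (B *m B^T).
have BBu : B *m B^T \in unitmx by apply: gram_unitmx; exact: row_base_free.
have GT : G^T = G by rewrite trmx_inv trmx_mul trmxK.
(* The orthogonal projection onto the complement of the row space of [M]. *)
pose Q : 'M[F]_N := 1%:M - B^T *m G *m B.
have BQ : B *m Q = 0.
  by rewrite mulmxBr mulmx1 !mulmxA mulmxV// mul1mx subrr.
have MQ : M *m Q = 0 by rewrite -(mulmx_base M) -mulmxA BQ mulmx0.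
have QT : Q^T = Q.
  by rewrite /Q [LHS]linearB/= trmx1 (trmx_mul _ B) (trmx_mul B^T) trmxK GT mulmxA.
have QQ : Q *m Q = Q.
  by rewrite {1}/Q mulmxBl mul1mx -(mulmxA _ B) BQ mulmx0 subr0.
(* By cyclicity, the trace of [B^T *m G *m B] is that of the identity of size [\rank M]. *)
have trQ : \tr Q = N%:R - (\rank M)%:R.
  rewrite /Q [LHS]linearB/= mxtrace1 -mulmxA mxtrace_mulC -mulmxA mulVmx//.
  by rewrite mxtrace1.
set D := 1%:M - M.
have DQ : D *m Q = Q by rewrite mulmxBl mul1mx MQ subr0.
have QD : Q *m D^T = Q by rewrite -[in LHS]QT -trmx_mul DQ.
have := mxtrace_mul_tr_ge0 (D - Q).
rewrite [(D - Q)^T]linearB/= QT (mulmxBl D) (mulmxBr D) (mulmxBr Q) DQ QD QQ.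
by rewrite subrr subr0 [\tr _]linearB/= trQ subr_ge0.
Qed.

End frobenius.

Section L2_inner_product.
Context {d : measure_display} {T : measurableType d} {R : realType}.
Variable mu : {measure set T -> \bar R}.
Implicit Types (u v w : L2 mu) (a : R).

Lemma L2dotC u v : L2dot u v = L2dot v u.
Proof. by apply: eq_Rintegral => x _; rewrite mulrC. Qed.

Lemma L2dot0l w : L2dot 0 w = 0.
Proof. by have := L2dotP (-1) 0 0 w; rewrite scaler0 addr0 mulN1r addNr. Qed.

Lemma L2dotDl u v w : L2dot (u + v) w = L2dot u w + L2dot v w.
Proof. by have := L2dotP 1 u v w; rewrite scale1r mul1r. Qed.

Lemma L2dotZl a u w : L2dot (a *: u) w = a * L2dot u w.
Proof. by have := L2dotP a u 0 w; rewrite addr0 L2dot0l addr0. Qed.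

Lemma L2dotBl u v w : L2dot (u - v) w = L2dot u w - L2dot v w.
Proof. by rewrite L2dotDl -scaleN1r L2dotZl mulN1r. Qed.

Lemma L2dot_suml (I : finType) (f : I -> L2 mu) w :
  L2dot (\sum_i f i) w = \sum_i L2dot (f i) w.
Proof.
apply: (big_morph (fun u => L2dot u w)); last exact: L2dot0l.
by move=> u v; rewrite L2dotDl.
Qed.

Lemma L2norm_sqr u : `|u| ^+ 2 = L2dot u u.
Proof.
have -> : `|u| = L2norm u by [].
rewrite /L2norm /L2dot /Rintegral -powR_mulrn ?fine_ge0 ?Lnorm_ge0//.
rewrite -fine_poweR poweR_Lnorm//; congr fine.
apply: eq_integral => x _ /=.
by rewrite powR_mulrn// real_normK ?num_real// expr2.
Qed.

Lemma L2dot_ge0 u : 0 <= L2dot u u.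
Proof. by rewrite -L2norm_sqr sqr_ge0. Qed.

(** The projection [s] of [u] onto the span has [<s, u> = <s, s>], both equal to the left-hand sum,
    so the bound is [0 <= <u - s, u - s>]. *)
Lemma L2_bessel N (e : 'I_N -> L2 mu) u :
  (forall k l, L2dot (e k) (e l) = (k == l)%:R) ->
  \sum_k L2dot u (e k) ^+ 2 <= `|u| ^+ 2.
Proof.
move=> eON; rewrite L2norm_sqr.
pose s := \sum_k L2dot u (e k) *: e k.
have dots w : L2dot s w = \sum_k L2dot u (e k) * L2dot (e k) w.
  by rewrite L2dot_suml; apply: eq_bigr => k _; rewrite L2dotZl.
have su : L2dot s u = \sum_k L2dot u (e k) ^+ 2.
  by rewrite dots; apply: eq_bigr => k _; rewrite (L2dotC (e k)) expr2.
have se k : L2dot s (e k) = L2dot u (e k).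
  rewrite dots (bigD1 k)//= big1 ?addr0 ?eON ?eqxx ?mulr1// => l lk.
  by rewrite eON (negbTE lk) mulr0.
have ss : L2dot s s = \sum_k L2dot u (e k) ^+ 2.
  rewrite dots; apply: eq_bigr => k _.
  by rewrite (L2dotC (e k)) se expr2.
have := L2dot_ge0 (u - s).
rewrite L2dotBl (L2dotC u) (L2dotC s) !L2dotBl (L2dotC u s) su ss subrr subr0.
by rewrite subr_ge0.
Qed.

(** Row [k] of [S *m V] lists the coordinates along [e] of the approximant of [e k]. By Bessel, the
    sum dominates the squared Frobenius norm of [1 - S *m V], and [S *m V] factors through dimension
    [n]. *)
Lemma orthonormal_dist_span N n (e : 'I_N -> L2 mu) (v : 'I_n -> L2 mu)
    (c : 'I_N -> 'I_n -> R) :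
  (forall k l, L2dot (e k) (e l) = (k == l)%:R) ->
  N%:R - n%:R <= \sum_k `|e k - \sum_i c k i *: v i| ^+ 2.
Proof.
move=> eON.
pose S := \matrix_(k, i) c k i; pose V := \matrix_(i, l) L2dot (v i) (e l).
have rkSV : (\rank (S *m V) <= n)%N by exact: mulmx_max_rank.
have := frobenius_sub1_ge (S *m V); rewrite mxtrace_mul_tr => SV.
apply: (le_trans (y := N%:R - (\rank (S *m V))%:R)).
  by rewrite lerD2l lerN2 ler_nat.
apply: (le_trans SV); apply: ler_sum => k _.
apply: le_trans (L2_bessel _ eON).
apply: ler_sum => l _; rewrite L2dotBl eON L2dot_suml.
rewrite !mxE le_eqVlt; apply/orP; left; apply/eqP; congr ((_ - _) ^+ 2).
by apply: eq_bigr => i _; rewrite !mxE L2dotZl.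
Qed.

Lemma exists_orthonormal_far n (e : 'I_(n + n) -> L2 mu) (v : 'I_n -> L2 mu)
    (c : 'I_(n + n) -> 'I_n -> R) :
  (0 < n)%N -> (forall k l, L2dot (e k) (e l) = (k == l)%:R) ->
  exists k, 2^-1 <= `|e k - \sum_i c k i *: v i|.
Proof.
move=> n0 eON; apply: contrapT => /forallNP small.
have := orthonormal_dist_span v c eON; rewrite natrD addrK leNgt => /negP; apply.
(* If all distances were below [1/2], their squares would add up to at most [2n/4 = n/2 < n]. *)
apply: (@le_lt_trans _ _ (\sum_(k < n + n) 2^-1 ^+ 2)).
  apply: ler_sum => k _; rewrite ler_sqr ?nnegrE ?invr_ge0//.
  by have /negP := small k; rewrite -ltNge => /ltW.
rewrite sumr_const card_ord -[_ *+ (n + n)]mulr_natr natrD.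
by have : 0 < n%:R :> R by [rewrite ltr0n]; lra.
Qed.

End L2_inner_product.

Section wiener_basis.
Context {d : measure_display} {T : measurableType d} {R : realType}.
Variables (mu : {measure set T -> \bar R}) (e : nat -> L2 mu) (r p : R).
Hypothesis p01 : 0 < p <= 1.
Hypothesis eON : forall m n, L2dot (e m) (e n) = (m == n)%:R.

Lemma wiener_enorm_scale_basis (a : R) k :
  wiener_enorm e r p (a *: e k) = (`|a| * (1 + k%:R) `^ r)%:E.
Proof.
have /andP[p0 _] := p01; rewrite /wiener_enorm.
rewrite (@nneseriesD1 _ _ k)//.
rewrite eseries0 ?adde0; last first.
  move=> n _ /= nk; rewrite L2dotZl eON eq_sym (negbTE nk) mulr0 mul0r normr0.
  (* Positivity of [p] matters here: [powR] sends [0] to the power [0] to [1]. *)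
  by rewrite powR0// gt_eqF.
rewrite L2dotZl eON eqxx mulr1 poweR_EFin -powRrM divff ?gt_eqF// powRr1//.
by rewrite normrM (ger0_norm (powR_ge0 _ _)).
Qed.

Lemma scale_basis_wiener_pred (a : R) k : a *: e k \in wiener_pred e r p01.
Proof.
apply/asboolP; split; first by rewrite wiener_enorm_scale_basis ltry.
(* Partial sums run over indices below [n], so they are constant as soon as [k < n]. *)
apply: (@cvg_near_cst _ _ (a *: e k)); near=> n.
rewrite seriesEord/= (bigD1 (Ordinal (_ : (k < n)%N)))//=.
  by near: n; exact: nbhs_infty_gt.
move=> kn; rewrite big1 ?addr0.
  by rewrite L2dotZl eON eqxx mulr1.
move=> i ik; rewrite L2dotZl eON [k == i]eq_sym.
by rewrite (negbTE (_ : val i != k))// mulr0 scale0r.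
Unshelve. all: by end_near. Qed.

Lemma approximation_number_wiener_ge n : 0 <= r -> (0 < n)%N ->
  (((2%:R `^ (- r) / 2) * n%:R `^ (- r))%:E <=
    approximation_number (@wiener_norm _ _ _ _ e r p p01)
      (\val : wiener e r p01 -> L2 mu) n)%E.
Proof.
move=> r0 n0; apply: le_ereal_inf_tmp => _ [A [_ [v Av]] <-].
pose f k : wiener e r p01 := Wiener (scale_basis_wiener_pred 1 k).
have [c Ac] := choice (fun k : 'I_(n + n) => Av (f k)).
have [|k ke] := @exists_orthonormal_far _ _ _ mu n (e \o val) v c n0.
  by move=> k l; rewrite eON.
(* As [k < 2n], the weight [(1 + k)^r] is at most [(2n)^r], so this factor brings every [f k] into
   the unit ball. *)
pose a : R := (n + n)%:R `^ (- r).
have a0 : 0 <= a by exact: powR_ge0.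
have qf : wiener_norm (a *: f k) <= 1.
  rewrite /wiener_norm linearZ/= scale1r wiener_enorm_scale_basis/=.
  rewrite ger0_norm// /a powRN mulrC ler_pdivrMr ?powR_gt0 ?ltr0n ?addn_gt0 ?n0//.
  rewrite mul1r; apply: ge0_ler_powR => //; rewrite ?nnegrE ?addr_ge0//.
  by rewrite nat1r ler_nat.
apply: le_ereal_sup_tmp; exists `|val (a *: f k) - A (a *: f k)|%:E.
  by exists (a *: f k).
(* Linearity of [A] pulls [a] out of the error, leaving the distance bounded by [ke]. *)
rewrite lee_fin !linearZ/= -scalerDr normrZ ger0_norm// Ac scale1r.
have -> : 2%:R `^ (- r) / 2 * n%:R `^ (- r) = a * 2^-1.
  by rewrite /a mulrAC -powRM// -natrM mul2n addnn.
by rewrite ler_wpM2l.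
Qed.

End wiener_basis.

Theorem corollary4p12 (R : realType) (alpha r p : R) (P : nat -> {poly R})
    (halpha : alpha = - 2^-1 \/ alpha = 0) (hr : 0 < r) (hp : 0 < p <= 1)
    (hP : orthonormal_polys alpha P) :
  exists C : R, 0 < C /\
    forall n : nat, (0 < n)%N ->
      ((C * n%:R `^ (- r))%:E <=
        approximation_number
          (@wiener_norm _ _ _ _ (fun k => polyL2 alpha (P k)) r p hp)
          (\val : wiener (fun k => polyL2 alpha (P k)) r hp ->
                  L2 (jacobi_measure alpha)) n)%E.
Proof.
have [_ _ PON] := hP.
exists (2%:R `^ (- r) / 2); split; first by rewrite divr_gt0// powR_gt0.
move=> n n0; exact: approximation_number_wiener_ge (ltW hr) n0.
Qed.
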